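(* Let $n\ge2$ and $k\ge1$ be integers. Then \[ \gamma_{[k]R}(C_8\Box P_n)\le 2n(k+1)-\left(\left\lfloor\frac{n-2}{5}\right\rfloor+\left\lfloor\frac n5\right\rfloor\right)+2k. \]
   Context: For a graph $G$ and $v\in V(G)$, $N(v)$ is the open neighborhood and $N[v]=N(v)\cup\{v\}$. For an integer $k\ge1$, a function $f:V(G)\to\{0,1,\dots,k+1\}$ is a $[k]$-Roman dominating function if for every vertex $v$ with $f(v)<k$ we have $\sum_{u\in N[v]}f(u)\ge k+|\{u\in N(v): f(u)>0\}|$. The weight of $f$ is $\sum_{v}f(v)$, and $\gamma_{[k]R}(G)$ is the minimum weight of a $[k]$-Roman dominating function on $G$. $C_m\Box P_n$ is the Cartesian product of the cycle $C_m$ (vertices $0,\dots,m-1$ mod $m$) and the path $P_n$ (vertices $0,\dots,n-1$): $(i,j)\sim(i',j')$ iff ($i=i'$ and $|j-j'|=1$) or ($j=j'$ and $i'\equiv i\pm1 \pmod m$). *)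

(* Defs.v *)
(* MathComp *)
From mathcomp Require Import all_boot.

Set Implicit Arguments.
Unset Strict Implicit.
Unset Printing Implicit Defensive.

Section KRomanDomination.

(* A finite simple graph is given by its adjacency relation e, meant to be
   symmetric and irreflexive. *)
Variables (T : finType) (e : rel T) (k : nat).

Definition nbh (v : T) : {set T} := [set u | e v u].

Definition cnbh (v : T) : {set T} := v |: nbh v.

Definition is_kRDF (f : {ffun T -> 'I_k.+2}) : bool :=
  [forall v, (f v < k) ==>
     (k + #|[set u in nbh v | 0 < f u]| <= \sum_(u in cnbh v) f u)].

Definition weight (f : {ffun T -> 'I_k.+2}) : nat := \sum_v f v.

(* The constant function k + 1, always [k]-Roman dominating, only serves as the
   witness that the minimum is taken over a nonempty set (see gamma_kR_min). *)
Definition gamma_kR : nat :=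
  weight [arg min_(f < [ffun=> ord_max] | is_kRDF f) weight f].

Lemma is_kRDF_max : is_kRDF [ffun=> ord_max].
Proof.
by apply/forallP=> v; rewrite ffunE /= ltnNge leqnSn.
Qed.

Lemma gamma_kR_min :
  (exists2 f, is_kRDF f & weight f = gamma_kR) /\
  (forall f, is_kRDF f -> gamma_kR <= weight f).
Proof.
rewrite /gamma_kR; case: arg_minnP => [|f Hf fmin]; first exact: is_kRDF_max.
by split=> //; exists f.
Qed.

End KRomanDomination.

Definition cycle_adj (m : nat) : rel 'I_m :=
  [rel i j : 'I_m | (j == i.+1 %[mod m]) || (i == j.+1 %[mod m])].

Definition path_adj (n : nat) : rel 'I_n :=
  [rel i j : 'I_n | (j == i.+1 :> nat) || (i == j.+1 :> nat)].

Definition cart_adj (S T : finType) (e : rel S) (e' : rel T) : rel (S * T) :=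
  [rel x y | (x.1 == y.1) && e' x.2 y.2 || (x.2 == y.2) && e x.1 y.1].

Definition CboxP (m n : nat) : rel ('I_m * 'I_n) :=
  cart_adj (@cycle_adj m) (@path_adj n).

Lemma CboxP_sym m n : symmetric (@CboxP m n).
Proof.
move=> x y; rewrite /CboxP /cart_adj /cycle_adj /path_adj /=.
by rewrite (eq_sym y.1) (eq_sym y.2) (orbC (y.1 == _ %[mod m]))
           (orbC (nat_of_ord y.2 == _)).
Qed.

Lemma CboxP_irr m n : 1 < m -> irreflexive (@CboxP m n).
Proof.
move=> m_gt1 x; rewrite /CboxP /cart_adj /cycle_adj /path_adj /=.
rewrite !eqxx /= !orbb (ltn_eqF (ltnSn _)) /=.
by rewrite -{1}[nat_of_ord x.1]addn0 -addn1 eqn_modDl mod0n modn_small.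
Qed.

(* Main.v *)
(* There is a dominating set of C_8 x Z of period 10, with 9 vertices in every
   5 consecutive columns, whose columns 0, 1, 2, ... already dominate the
   half-infinite cylinder.  Give k + 1 to its vertices in the columns
   0, ..., n - 1.  The only vertices left undominated are those of column n - 1
   whose missing neighbour in column n lies in the set; giving them k makes them
   satisfied. *)
Require Import Defs.
From mathcomp Require Import all_boot zify.

(** Only a vertex outside [A] and [B] can have value below [k]. Its neighbour in [A] adds [k + 1] to
    the sum and 1 to the count, a surplus of [k]. *)
Lemma gamma_kR_le (T : finType) (e : rel T) (k : nat) (A B : {set T}) :
  (forall v, v \notin A -> v \notin B -> exists2 u, u \in A & e v u) ->
  gamma_kR e k <= (k + 1) * #|A| + k * #|B|.
Proof.
move=> domA.
pose f : {ffun T -> 'I_k.+2} :=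
  [ffun v => if v \in A then ord_max else if v \in B then inord k else ord0].
have fE v : f v = (if v \in A then k.+1 else if v \in B then k else 0) :> nat.
  by rewrite ffunE; case: ifP => // _; case: ifP => // _; rewrite inordK.
have f_rdf : is_kRDF e f.
  apply/forallP => v; apply/implyP; rewrite fE.
  case: ifPn => [|vA]; first by rewrite ltnNge leqnSn.
  case: ifPn => [|vB _]; first by rewrite ltnn.
  have [u uA evu] := domA v vA vB.
  have uN : u \in nbh e v by rewrite inE.
  apply: (@leq_trans (\sum_(w in nbh e v) f w)); last first.
    rewrite [leqRHS](bigID (mem (nbh e v))) /=.
    rewrite [X in _ <= X + _](eq_bigl (mem (nbh e v))) ?leq_addr // => w.
    by rewrite !inE andbC; case: (e v w); rewrite ?orbT.
  have -> : #|[set w in nbh e v | 0 < f w]| = \sum_(w in nbh e v) (0 < f w).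
    by rewrite -sum1dep_card big_mkcondr; apply: eq_bigr => w _; case: ifP.
  rewrite !(bigD1 u uN) /= [X in _ <= X + _]fE uA.
  have -> : 0 < f u by rewrite fE uA.
  (* Any other positive neighbour adds 1 to the count and at least 1 to the sum. *)
  rewrite addnA addn1 leq_add2l; apply: leq_sum => w _.
  by case: (nat_of_ord (f w)).
apply: leq_trans ((gamma_kR_min e k).2 f f_rdf) _.
rewrite /weight ![_ * #|_|]mulnC -!sum_nat_const.
rewrite (big_mkcond (mem A)) (big_mkcond (mem B)) -big_split /=.
apply: leq_sum => v _; rewrite fE addn1.
by case: ifP => _; rewrite ?leq_addr ?add0n //; case: ifP.
Qed.

(** The last five columns are the first five rotated by 4 around the cycle, so the column sizes have
    period 5. *)
Definition pattern (j : nat) : seq nat :=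
  nth [::] [:: [:: 0; 2; 4]; [:: 6]; [:: 1; 3]; [:: 5; 7]; [:: 2];
               [:: 0; 4; 6]; [:: 2]; [:: 5; 7]; [:: 1; 3]; [:: 6]] (j %% 10).

Lemma pattern_mod j : pattern (j %% 10) = pattern j.
Proof. by rewrite /pattern modn_mod. Qed.

Lemma pattern_modD i j : pattern (i %% 10 + j) = pattern (i + j).
Proof. by rewrite -pattern_mod modnDml pattern_mod. Qed.

(* Modulo the period, [j + 9] is the column before [j]. *)
Lemma pattern_dominates (i j : nat) : i < 8 ->
  [|| i \in pattern j, i.+1 %% 8 \in pattern j, (i + 7) %% 8 \in pattern j,
      i \in pattern j.+1 | (0 < j) && (i \in pattern (j + 9))].
Proof.
move=> i_lt8.
(* By periodicity 80 cases suffice; the test [0 < r] bars the preceding column at every multiple of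
   10, not just at [j = 0]. *)
have : all (fun r => all (fun i => [|| i \in pattern r,
      i.+1 %% 8 \in pattern r, (i + 7) %% 8 \in pattern r,
      i \in pattern r.+1 | (0 < r) && (i \in pattern (r + 9))]) (iota 0 8))
    (iota 0 10) by [].
move/allP/(_ (j %% 10)); rewrite mem_iota ltn_mod => /(_ isT).
move/allP/(_ i); rewrite mem_iota => /(_ i_lt8).
rewrite -[(j %% 10).+1]addn1 !pattern_modD addn1 pattern_mod.
case/or4P => [->|->|->|/orP[->|/andP[j10 ->]]]; rewrite ?orbT //.
have -> : 0 < j by case: (j) j10.
by rewrite !orbT.
Qed.

Lemma card_pattern j :
  \sum_(i < 8) (nat_of_ord i \in pattern j) = nth 0 [:: 3; 1; 2; 2; 1] (j %% 5).
Proof.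
rewrite -(@modn_dvdm 10 j 5) // /pattern !big_ord_recl big_ord0 /=.
by move: (j %% 10) (ltn_pmod j (isT : 0 < 10)); do 10?case.
Qed.

(** Here 9 = 3 + 1 + 2 + 2 + 1, and the list holds the partial sums. *)
Lemma sum_card_pattern n :
  \sum_(j < n) \sum_(i < 8) (nat_of_ord i \in pattern j)
    = 9 * (n %/ 5) + nth 0 [:: 0; 3; 4; 6; 8] (n %% 5).
Proof.
elim: n => [|n IHn]; first by rewrite big_ord0.
rewrite big_ord_recr /= {}IHn card_pattern.
have := ltn_pmod n (isT : 0 < 5); have := divn_eq n 5.
move: (n %/ 5) (n %% 5) => q r -> r_lt5.
rewrite -addnS divnMDl // modnMDl.
by case: r r_lt5 => [|[|[|[|[|//]]]]] _ /=; lia.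
Qed.

Lemma sum_pair_card (m n : nat) (P : nat -> nat -> bool) :
  #|[set x : 'I_m * 'I_n | P x.1 x.2]| = \sum_(j < n) \sum_(i < m) P i j.
Proof.
rewrite exchange_big pair_bigA /= -sum1dep_card big_mkcond /=.
by apply: eq_bigr => x _; case: (P _ _).
Qed.

Theorem theorem19 (n k : nat) (hn : 2 <= n) (hk : 1 <= k) :
  gamma_kR (@CboxP 8 n) k
    <= 2 * n * (k + 1) - ((n - 2) %/ 5 + n %/ 5) + 2 * k.
Proof.
pose A := [set x : 'I_8 * 'I_n | nat_of_ord x.1 \in pattern x.2].
pose B := [set x : 'I_8 * 'I_n |
  (x.2.+1 == n) && (nat_of_ord x.1 \in pattern n)].
have domAB v : v \notin A -> v \notin B -> exists2 u, u \in A & CboxP v u.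
  case: v => i j; rewrite !inE /= => /negPf iA jB.
  have /or4P[|H|H|/orP[H|/andP[j_gt0 H]]] := pattern_dominates i j (ltn_ord i).
  - by rewrite iA.
  - exists (Ordinal (ltn_pmod i.+1 (isT : 0 < 8)), j); first by rewrite inE.
    by rewrite /CboxP /cart_adj /cycle_adj /= eqxx modn_mod eqxx /= orbT.
  - exists (Ordinal (ltn_pmod (i + 7) (isT : 0 < 8)), j); first by rewrite inE.
    have i7 : i == ((i + 7) %% 8).+1 %[mod 8] by lia.
    by rewrite /CboxP /cart_adj /cycle_adj /= eqxx i7 !orbT.
  - have jn : j.+1 < n.
      (* In the last column, membership of [i] in the next column would put the vertex in [B]. *)
      rewrite ltn_neqAle ltn_ord andbT; apply: contra jB => /eqP jn.
      by rewrite jn eqxx -{1}jn.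
    exists (i, Ordinal jn); first by rewrite inE.
    by rewrite /CboxP /cart_adj /path_adj /= !eqxx.
  - have jn : j.-1 < n by apply: leq_ltn_trans (leq_pred _) (ltn_ord j).
    exists (i, Ordinal jn).
      rewrite inE /= -pattern_mod.
      (* For positive [j], [j + 9] is [j.-1 + 10]. *)
      by rewrite -modnDr -{1}(prednK j_gt0) addSnnS pattern_mod in H *.
    by rewrite /CboxP /cart_adj /path_adj /= prednK // !eqxx orbT.
apply: leq_trans (gamma_kR_le _ _ k _ _ domAB) _.
have -> : #|A| = 9 * (n %/ 5) + nth 0 [:: 0; 3; 4; 6; 8] (n %% 5).
  by rewrite -sum_card_pattern -(sum_pair_card _ _ (fun i j => i \in pattern j)).
have -> : #|B| = nth 0 [:: 3; 1; 2; 2; 1] (n %% 5).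
  rewrite -card_pattern.
  rewrite (sum_pair_card _ _ (fun i j => (j.+1 == n) && (i \in pattern n))).
  case: n hn {A B domAB} => // n _; rewrite big_ord_recr /= eqxx big1 ?add0n //.
  by move=> j _; apply: big1 => i _; rewrite eqSS ltn_eqF.
have -> : (n - 2) %/ 5 = n %/ 5 - (n %% 5 < 2) by lia.
have := ltn_pmod n (isT : 0 < 5); have := divn_eq n 5.
move: (n %/ 5) (n %% 5) hn {A B domAB} => q r + nE; rewrite {n}nE.
(* Each full block of five columns leaves slack [k - 1]. For [r = 0] the remaining terms are [3 * k]
   against [2 * k + 1], and since [n >= 2] forces [q >= 1], one block pays the deficit. For the
   other [r] they fit by themselves. *)
by case: r => [|[|[|[|[|//]]]]] /= n_ge2 _; nia.
Qed.
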